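(* In the setting of the context, suppose $N\ge4$ and $\|\beta^v-\beta^k\|_2\ge2r$ for all $v\ne k$ (with $r>0$). Let $M$ be a (possibly randomized) $\mathbb R^d$-valued estimator, let $Q_v$ be the law of $M(\mathbf Z)$ when $\mathbf Z\sim P_v^{\otimes n}$, and put $$R=\max_{v\in[N]}\mathbb E_{P_v^{\otimes n}}\|M(\mathbf Z)-\beta^v\|_2^2 .$$ Then the averaged attack $$\overline{\mathcal A}=\frac1{N^2}\sum_{v,k=1}^N\sum_{\ell=1}^{L_{vk}}\sum_{i=1}^n\mathbb E_{R_{v,k,\ell,i-1}}\mathcal A_{v,k,\ell,i}(z_i,M(\mathbf Z))$$ satisfies the identity and the completeness bound $$\overline{\mathcal A}=\frac1{N^2}\sum_{v,k=1}^N\{Q_v(A_v)-Q_k(A_v)\},\qquad \overline{\mathcal A}\ge1-\frac R{r^2}-\frac1N .$$ Suppose in addition that every pair $P_v^{\otimes n},P_k^{\otimes n}$ has a coupling with expected Hamming distance at most $D$, and that $M$ is $(\varepsilon,\delta)$-differentially private. With $m=\lfloor20D\rfloor$ and $\delta_m=\delta\sum_{j=0}^{m-1}e^{j\varepsilon}$ (the sum being zero when $m=0$), the same attack satisfies the soundness bound $$\overline{\mathcal A}\le\frac{e^{m\varepsilon}-1}N+\frac1{20}+\delta_m .$$ Consequently, there are universal constants $c,C>0$ such that $$0<\varepsilon\le1,\qquad \varepsilon D\le c\log N,\qquad \delta\le c\,\varepsilon e^{-C\varepsilon D}$$ imply $R\ge cr^2$.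
   Context: Generalized linear model: an observation $z=(y,x)$ has $x\sim f_x$ on $\mathbb R^d$ and, given $x$, $y$ has density (with respect to a fixed dominating measure) $f_\beta(y\mid x)=h(y,\sigma)\exp\{(yx^\top\beta-\psi(x^\top\beta))/c(\sigma)\}$, a probability density for every $\beta\in\mathbb R^d$; $P_\beta$ denotes the law of one observation. All $P_\beta$ are mutually absolutely continuous. Packing: $S_1,\dots,S_N$ are distinct $s$-element subsets of $[d]$, $a>0$, $\beta^v=a\mathbf 1_{S_v}$ (where $\mathbf 1_S$ is the coordinate indicator vector of $S$), $P_v=P_{\beta^v}$, $v\in[N]$. Paths: the Johnson graph $J(d,s)$ has all $s$-subsets of $[d]$ as vertices, two being joined if one is obtained from the other by deleting one coordinate and inserting one coordinate. For each ordered pair $(v,k)$ choose a shortest path $S_{v,k,0}=S_k,S_{v,k,1},\dots,S_{v,k,L_{vk}}=S_v$ in $J(d,s)$ (so $L_{vv}=0$). Put $\beta_{v,k,\ell}=a\mathbf 1_{S_{v,k,\ell}}$, $P_{v,k,\ell}=P_{\beta_{v,k,\ell}}$, and $T_{v,k,\ell}(z)=\frac{dP_{v,k,\ell}}{dP_{v,k,\ell-1}}(z)-1$. Decoding cells: $\widehat v(u)=\min\{j\in[N]:\|u-\beta^j\|_2=\min_{k\in[N]}\|u-\beta^k\|_2\}$ and $A_v=\{u\in\mathbb R^d:\widehat v(u)=v\}$. Interpolating laws: $R_{v,k,\ell,i}=P_{v,k,\ell}^{\otimes i}\otimes P_{v,k,\ell-1}^{\otimes(n-i)}$ for $\mathbf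 Z=(z_1,\dots,z_n)$, i.e. the first $i$ observations have law $P_{v,k,\ell}$ and the rest $P_{v,k,\ell-1}$. Attack: $\mathcal A_{v,k,\ell,i}(z_i,M(\mathbf Z))=\mathbf 1\{M(\mathbf Z)\in A_v\}\,T_{v,k,\ell}(z_i)$. Expectations are over $\mathbf Z$ with the indicated law and the internal randomness of $M$. Differential privacy: $M$ is $(\varepsilon,\delta)$-differentially private if for every two data sets $D,D'$ of size $n$ differing by replacement of one record and every measurable $S$, $\mathbb P(M(D)\in S)\le e^\varepsilon\mathbb P(M(D')\in S)+\delta$ (probability over $M$ only). The Hamming distance between two data sets of size $n$ is the number of indices at which they differ. *)

(* Defs.v *)
From HB Require Import structures.
From mathcomp Require Import all_boot all_order all_algebra.
From mathcomp Require Import all_classical all_reals all_analysis.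
Import Order.TTheory GRing.Theory Num.Theory.
Import numFieldNormedType.Exports.
Set Implicit Arguments.
Unset Strict Implicit.
Unset Printing Implicit Defensive.
Local Open Scope classical_set_scope.
Local Open Scope ring_scope.
Local Open Scope charge_scope.

(* R^d carries the sigma-algebra generated by the coordinates, i.e. its Borel
   sigma-algebra. *)
Section measurable_rV.
Context (R : realType) (d : nat).
Let coord (i : 'I_d) (u : 'rV[R]_d) : R := u ord0 i.

Let rV_set0 : g_sigma_preimage coord set0.
Proof. exact: sigma_algebra0. Qed.

Let rV_setC A : g_sigma_preimage coord A -> g_sigma_preimage coord (~` A).
Proof. exact: sigma_algebraC. Qed.

Let rV_bigcup (F : (set 'rV[R]_d)^nat) :
  (forall i, g_sigma_preimage coord (F i)) ->
  g_sigma_preimage coord (\bigcup_i F i).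
Proof. exact: sigma_algebra_bigcup. Qed.

HB.instance Definition _ := @isMeasurable.Build
  (measure_tuple_display default_measure_display)
  'rV[R]_d (g_sigma_preimage coord) rV_set0 rV_setC rV_bigcup.
End measurable_rV.

Lemma measurable_rV_coord (R : realType) (d : nat) (i : 'I_d) :
  measurable_fun [set: 'rV[R]_d] (fun u => u ord0 i : R).
Proof.
move=> _ Y mY; rewrite setTI; apply: sub_sigma_algebra => /=.
rewrite -bigcup_seq/=; exists i => /=; first by rewrite mem_index_enum.
by exists Y => //; rewrite setTI.
Qed.

(* The library's norm on 'rV is the sup norm, hence a separate Euclidean norm. *)
Definition l2norm (R : realType) (d : nat) (u : 'rV[R]_d) : R :=
  Num.sqrt (\sum_(j < d) u ord0 j ^+ 2).

Definition indvec (R : realType) (d : nat) (A : {set 'I_d}) : 'rV[R]_d :=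
  \row_(j < d) (j \in A)%:R.

Section product_law.
Context d (T : measurableType d) (R : realType).

Definition tuple_cons n (z : T * n.-tuple T) : n.+1.-tuple T :=
  [tuple of z.1 :: z.2].

Lemma measurable_tuple_cons n : measurable_fun [set: T * n.-tuple T] (@tuple_cons n).
Proof. by apply: measurable_cons. Qed.

HB.instance Definition _ n :=
  isMeasurableFun.Build _ _ _ _ (@tuple_cons n) (@measurable_tuple_cons n).

(* Law of (z_0, ..., z_(n-1)) with independent coordinates z_j ~ mu j. *)
Fixpoint product_law n (mu : nat -> probability T R) : probability (n.-tuple T) R :=
  match n with
  | 0 => dirac [tuple]
  | m.+1 => distribution (mu 0%N \x product_law m (fun j => mu j.+1))%E
                         (@tuple_cons m)
  end.

Lemma product_law_box n (mu : nat -> probability T R) (A : nat -> set T) :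
  (forall j, measurable (A j)) ->
  product_law n mu [set t | forall j : 'I_n, A j (tnth t j)] =
  (\prod_(j < n) mu j (A j))%E.
Proof.
elim: n mu A => [|n IH] mu A mA /=.
  rewrite big_ord0 diracE mem_set//=; first by case.
rewrite big_ord_recl -(IH (fun j => mu j.+1) (fun j => A j.+1))//.
rewrite -product_measure1E//; last first.
  rewrite [X in measurable X](_ : _ =
    \bigcap_(j in [set: 'I_n]) ((@tnth n T ^~ j) @^-1` A j.+1)); last first.
    by apply/seteqP; split => t /= + j; [move=> + _|move=> /(_ j I)]; exact.
  apply: fin_bigcap_measurable => // j _.
  rewrite -[X in measurable X]setTI; exact: measurable_tnth.
rewrite /distribution /pushforward; congr (_ _).
apply/seteqP; split => -[x t] /=.
  move=> H; split => [|j]; first exact: (H ord0).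
  by have := H (lift ord0 j); rewrite tnthS.
move=> [Hx Ht] j; case: (unliftP ord0 j) => [i ->|->]; last exact: Hx.
by rewrite tnthS; exact: Ht.
Qed.

End product_law.

Section glm.
Context (R : realType) (d : nat).
Local Notation vec := 'rV[R]_d.

Definition glm_density (h : R -> R -> R) (psi cc : R -> R) (sigma : R)
    (b x : vec) (y : R) : R :=
  let eta := (x *m b^T) ord0 ord0 in
  h y sigma * expR ((y * eta - psi eta) / cc sigma).

(* An observation is z = (y, x). *)
Record glm := Glm {
  glm_fx : probability vec R ;
  glm_nu : {sigma_finite_measure set R -> \bar R} ;
  glm_h : R -> R -> R ;
  glm_psi : R -> R ;
  glm_c : R -> R ;
  glm_sigma : R ;
  glm_law : vec -> probability (R * vec)%type R ;
  glm_c_neq0 : glm_c glm_sigma != 0 ;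
  glm_h_ge0 : forall y, 0 <= glm_h y glm_sigma ;
  glm_density_measurable : forall b, measurable_fun [set: R * vec]
    (fun z => glm_density glm_h glm_psi glm_c glm_sigma b z.2 z.1) ;
  glm_density1 : forall b x, (\int[glm_nu]_y
    (glm_density glm_h glm_psi glm_c glm_sigma b x y)%:E = 1)%E ;
  glm_lawE : forall b (A : set (R * vec)), measurable A ->
    (glm_law b A = \int[glm_fx]_x \int[glm_nu]_y
      (\1_A (y, x) * glm_density glm_h glm_psi glm_c glm_sigma b x y)%:E)%E ;
  glm_law_abs_cont : forall b b', glm_law b `<< glm_law b'
}.

End glm.

Section johnson.
Context (d : nat).

Definition johnson (s : nat) : rel {set 'I_d} := fun A B =>
  [&& #|A| == s, #|B| == s &
    [exists i in A, exists j in ~: A, B == j |: (A :\ i)]].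

(* The path A :: p runs from A to B; its length (number of edges) is size p. *)
Definition shortest_path (s : nat) (A B : {set 'I_d}) (p : seq {set 'I_d}) : Prop :=
  [/\ path (johnson s) A p, last A p = B &
      forall q, path (johnson s) A q -> last A q = B -> (size p <= size q)%N].

Definition path_vertex (A : {set 'I_d}) (p : seq {set 'I_d}) (l : nat) : {set 'I_d} :=
  nth A (A :: p) l.

End johnson.

Section decoding.
Context (R : realType) (d N : nat) (beta : 'I_N -> 'rV[R]_d).

Definition nearest (u : 'rV[R]_d) (j : 'I_N) : bool :=
  [forall k, l2norm (u - beta j) <= l2norm (u - beta k)].

(* Least index of a nearest codeword; it is None only when N = 0. *)
Definition vhat (u : 'rV[R]_d) : option 'I_N :=
  [pick j | nearest u j & [forall k, nearest u k ==> (j <= k)%N]].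

Definition cell (v : 'I_N) : set 'rV[R]_d := [set u | vhat u = Some v].

Lemma vhat_total u : (0 < N)%N -> exists j, vhat u = Some j.
Proof.
move=> N0; rewrite /vhat; case: pickP => [j _|H]; first by exists j.
have [j0 _ Hj0] := @arg_minP _ _ _ (Ordinal N0) predT
  (fun j => l2norm (u - beta j)) isT.
have nj0 : nearest u j0 by apply/forallP => k; exact: Hj0.
have [j nj Hj] := arg_minnP (fun j : 'I_N => nat_of_ord j) nj0.
by have := H j; rewrite nj /= => /negP[]; apply/forallP => k; apply/implyP/Hj.
Qed.

End decoding.

Section estimation.
Context (R : realType) (d n : nat).
Local Notation vec := 'rV[R]_d.
Local Notation obs := (R * vec)%type.
Local Notation dataset := (n.-tuple obs).
Local Open Scope ereal_scope.

(* A randomized estimator is a Markov kernel: M Z is the law of M(Z) given Z. *)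
Definition estimator := R.-pker dataset ~> vec.

Definition iid (P : probability obs R) : probability dataset R :=
  product_law n (fun=> P).

(* The first i observations have law P', the remaining ones law P. *)
Definition interpolating_law (P' P : probability obs R) (i : nat) :
    probability dataset R :=
  product_law n (fun j => if (j < i)%N then P' else P).

(* Expectation of g Z (M Z) for Z ~ mu and over the randomness of M. *)
Definition expect (M : estimator) (mu : probability dataset R)
    (g : dataset -> vec -> \bar R) : \bar R :=
  \int[mu]_Z \int[M Z]_u g Z u.

Definition output_law (M : estimator) (mu : probability dataset R)
    (A : set vec) : \bar R :=
  \int[mu]_Z M Z A.

(* dP'/dP - 1 *)
Definition relative_score (P' P : probability obs R) (z : obs) : \bar R :=
  ('d (charge_of_finite_measure P') '/d P) z - 1.

Definition attack (A : set vec) (T : obs -> \bar R) (z : obs) (u : vec) : \bar R :=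
  (\1_A u)%:E * T z.

Definition hamming (Z Z' : dataset) : nat :=
  #|[set i : 'I_n | tnth Z i != tnth Z' i]|.

Definition diff_private (eps delta : R) (M : estimator) : Prop :=
  forall Z Z' : dataset, hamming Z Z' = 1%N ->
  forall A : set vec, measurable A ->
    M Z A <= (expR eps)%:E * M Z' A + delta%:E.

Definition coupling (P Q : probability dataset R)
    (gamma : probability (dataset * dataset)%type R) : Prop :=
  forall A : set dataset, measurable A ->
    gamma (A `*` [set: dataset]) = P A /\ gamma ([set: dataset] `*` A) = Q A.

Definition expected_hamming (gamma : probability (dataset * dataset)%type R) :
    \bar R :=
  \int[gamma]_w (hamming w.1 w.2)%:R%:E.

Definition max_risk (G : glm R d) (M : estimator) (N : nat)
    (beta : 'I_N -> vec) : \bar R :=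
  \big[maxe/-oo]_(v < N) expect M (iid (glm_law G (beta v)))
    (fun _ u => (l2norm (u - beta v) ^+ 2)%:E).

(* In the sum over i : 'I_n the observation z_(i+1) of the one-based indexing
   is tnth Z i, so that R_(v,k,l,i) there is the interpolating law at i here. *)
Definition averaged_attack (G : glm R d) (M : estimator) (N : nat) (a : R)
    (S : 'I_N -> {set 'I_d}) (p : 'I_N -> 'I_N -> seq {set 'I_d}) : \bar R :=
  let beta v := (a *: indvec R (S v))%R in
  let P v k l := glm_law G (a *: indvec R (path_vertex (S k) (p v k) l))%R in
  ((N%:R ^+ 2)^-1)%:E *
  \sum_(v < N) \sum_(k < N) \sum_(1 <= l < (size (p v k)).+1) \sum_(i < n)
    expect M (interpolating_law (P v k l) (P v k l.-1) i)
      (fun Z u => attack (cell beta v) (relative_score (P v k l) (P v k l.-1))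
                         (tnth Z i) u).

End estimation.

(* Main.v *)
Require Import Defs.
From HB Require Import structures.
From mathcomp Require Import all_boot all_order all_algebra.
From mathcomp Require Import all_classical all_reals all_analysis.
From mathcomp Require Import measurable_realfun.
From mathcomp Require Import ring lra.
Import Order.TTheory GRing.Theory Num.Theory.
Import numFieldNormedType.Exports.
Set Implicit Arguments.
Unset Strict Implicit.
Unset Printing Implicit Defensive.
Local Open Scope classical_set_scope.
Local Open Scope ring_scope.

(** The score of a step of a path is dP'/dP - 1, so weighting an observation of
    law P by it computes the effect of changing the law of that observation to
    P'. Hence the attack on observation i has expectation equal to the
    increment of the probability that the output lies in the cell when one more
    observation switches law ([expect_score_attack]). These increments
    telescope over the observations, from the product of the P to the product
    of the P', and then over the steps of the path from S_k to S_v; this is the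
    identity ([averaged_attackE]).

    The cells partition the output space, so for fixed k the numbers Q_k(A_v)
    sum to 1 and the average of the Q_k(A_v) over all pairs is 1/N. An output
    outside A_v is at least as close to another codeword as to beta^v; as the
    codewords are 2r apart, it is at distance at least r from beta^v, and
    Markov's inequality bounds the probability of this by R/r^2
    ([averaged_attack_complete]).

    For soundness, couple the samples of P_v and P_k. By Markov's inequality
    they differ in more than m records with probability at most 1/20, and when
    they do not, m applications of differential privacy compare the two output
    laws ([group_privacy], [diff_private_coupling]). This gives
    Q_v(A_v) <= e^(m eps) Q_k(A_v) + 1/20 + delta_m, which is then averaged
    over v and k ([averaged_attack_sound]).

    The universal constants are c = 1/100 and C = 21. The first makes e^(m eps)
    at most the square root of N, so that the term in 1/N is at most 1/4; with
    t = eps D, the second bounds delta_m by 20 c t e^(-t), hence by 1/5. The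
    attack is therefore at most 1/2, whereas R < c r^2 and N >= 4 would make it
    larger than 3/4 - 1/100. *)

(** * Changing the law of one coordinate of a product law *)

Section product_law_theory.
Context d (T : measurableType d) (R : realType).
Local Open Scope ereal_scope.
Implicit Types (mu : nat -> probability T R).

Lemma eq_product_law n mu mu' : (forall j, (j < n)%N -> mu j = mu' j) ->
  product_law n mu = product_law n mu'.
Proof.
elim: n mu mu' => [//|n IH] mu mu' mumu' /=.
by rewrite mumu'// (IH _ (fun j => mu' j.+1))// => j jn; exact: mumu'.
Qed.

Lemma ge0_integral_product_lawS n mu (f : n.+1.-tuple T -> \bar R) :
  measurable_fun [set: n.+1.-tuple T] f -> (forall Z, 0 <= f Z) ->
  \int[product_law n.+1 mu]_Z f Z =
  \int[mu 0%N]_x \int[product_law n (fun j => mu j.+1)]_t f (tuple_cons (x, t)).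
Proof.
move=> mf f0; rewrite [LHS]ge0_integral_distribution//.
rewrite [LHS]fubini_tonelli1//; last by move=> z; exact: f0.
exact: (measurableT_comp mf (@measurable_tuple_cons _ _ n)).
Qed.

Lemma tuple_cons_tnthS n (z : T * n.-tuple T) (i : 'I_n) :
  tnth (tuple_cons z) (lift ord0 i) = tnth z.2 i.
Proof. by rewrite /tuple_cons tnthS. Qed.

Lemma product_law_tnth n mu (i : 'I_n) (A : set T) : measurable A ->
  product_law n mu ((@tnth n T ^~ i) @^-1` A) = mu i A.
Proof.
move=> mA; pose B j := if j == i :> nat then A else setT.
have mB j : measurable (B j) by rewrite /B; case: ifP.
transitivity (product_law n mu [set t | forall j : 'I_n, B j (tnth t j)]).
  congr (product_law n mu _); apply/seteqP; split => t /=.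
    by move=> At j; rewrite /B; case: eqP => // /val_inj ->.
  by move=> /(_ i); rewrite /B eqxx.
rewrite (product_law_box n mu mB) (bigD1 i)//= /B eqxx big1 ?mule1// => j ji.
by rewrite (negbTE ji : (j == i :> nat) = false) probability_setT.
Qed.

(** By Tonelli the integral over coordinate [i] can be isolated, and there the
    change of variables for the two laws of that coordinate applies. The
    density [g] enters only through that change of variables, for nonnegative
    functions, which avoids integrability conditions. *)
Lemma product_law_density n mu mu' (i : 'I_n) (g : T -> \bar R)
    (f : n.-tuple T -> \bar R) :
  (forall j, j != i :> nat -> mu' j = mu j) ->
  measurable_fun setT g -> (forall x, 0 <= g x) ->
  (forall phi : T -> \bar R, measurable_fun setT phi -> (forall x, 0 <= phi x) ->
     \int[mu' i]_x phi x = \int[mu i]_x (g x * phi x)) ->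
  measurable_fun [set: n.-tuple T] f -> (forall Z, 0 <= f Z) ->
  \int[product_law n mu']_Z f Z =
  \int[product_law n mu]_Z (g (tnth Z i) * f Z).
Proof.
elim: n mu mu' i f => [|n IH] mu mu' i f; first by case: i.
move=> mumu' mg g0 gE mf f0.
have mfc : measurable_fun setT (f \o @tuple_cons _ T n).
  exact: (measurableT_comp mf (@measurable_tuple_cons _ _ n)).
rewrite !ge0_integral_product_lawS//; last 2 first.
- apply: emeasurable_funM => //.
  exact: (measurableT_comp mg (@measurable_tnth _ T _ i)).
- by move=> Z; rewrite mule_ge0.
case: (unliftP ord0 i) mumu' gE => [k ->|->] mumu' gE.
- rewrite mumu'//; apply: eq_integral => x _.
  under [RHS]eq_integral do rewrite tuple_cons_tnthS.
  apply: (IH _ _ k (fun t => f (tuple_cons (x, t)))) => //.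
    by move=> j jk; rewrite mumu'.
  exact: (measurableT_comp mfc (pair1_measurable x)).
- have -> : (fun j => mu' j.+1) = (fun j => mu j.+1).
    by apply/funext => j; rewrite mumu'.
  rewrite gE; last 2 first.
  + by apply: (measurable_fun_fubini_tonelli_F _ mfc) => z; exact: f0.
  + by move=> x; exact: integral_ge0.
  apply: eq_integral => x _; rewrite -ge0_integralZl//.
  exact: (measurableT_comp mfc (pair1_measurable x)).
Qed.

End product_law_theory.

(** * The expected attack on one observation *)

Lemma ge0_integrable d (T : measurableType d) (R : realType)
    (mu : {measure set T -> \bar R}) (f : T -> \bar R) :
  measurable_fun setT f -> (forall x, 0 <= f x)%E ->
  (\int[mu]_x f x < +oo)%E -> mu.-integrable setT f.
Proof.
move=> mf f0 foo; apply/integrableP; split => //.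
by under eq_integral do rewrite gee0_abs//.
Qed.

Section probability_integral.
Context d (T : measurableType d) (R : realType) (P : probability T R).
Local Open Scope ereal_scope.

Lemma integral_prob_cst (c : \bar R) : \int[P]_x c = c.
Proof. by rewrite integral_cst//= probability_setT mule1. Qed.

Lemma integral_prob_le1 (f : T -> \bar R) : measurable_fun setT f ->
  (forall x, 0 <= f x) -> (forall x, f x <= 1) -> \int[P]_x f x <= 1.
Proof.
by move=> mf f0 f1; rewrite -[leRHS]integral_prob_cst; exact: ge0_le_integral.
Qed.

End probability_integral.

Section score_attack.
Context (R : realType) (d n : nat).
Local Notation vec := 'rV[R]_d.
Local Notation obs := (R * vec)%type.
Local Open Scope ereal_scope.
Implicit Types (M : estimator R d n) (A : set vec).
Implicit Types (mu : nat -> probability obs R).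

Lemma estimator_le1 M Z A : measurable A -> M Z A <= 1.
Proof.
move=> mA; rewrite -(prob_kernel (s := M) Z).
by apply: le_measure; rewrite ?inE.
Qed.

Lemma estimator_fin_num M Z A : measurable A -> M Z A \is a fin_num.
Proof.
move=> mA; rewrite ge0_fin_numE//.
exact: le_lt_trans (estimator_le1 _ _ mA) (ltry _).
Qed.

Lemma output_law_ge0 M (P : probability (n.-tuple obs) R) A :
  0 <= output_law M P A.
Proof. exact: integral_ge0. Qed.

Lemma output_law_le1 M (P : probability (n.-tuple obs) R) A : measurable A ->
  output_law M P A <= 1.
Proof.
move=> mA; apply: integral_prob_le1 => //; first exact: measurable_kernel.
by move=> Z; exact: estimator_le1.
Qed.

Lemma output_law_fin_num M (P : probability (n.-tuple obs) R) A :
  measurable A -> output_law M P A \is a fin_num.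
Proof.
move=> mA; rewrite ge0_fin_numE ?output_law_ge0//.
exact: le_lt_trans (output_law_le1 _ _ mA) (ltry _).
Qed.

Lemma integral_attack M Z A (c : \bar R) : measurable A -> c \is a fin_num ->
  \int[M Z]_u ((\1_A u)%:E * c) = c * M Z A.
Proof.
move=> mA /fineK <-; under eq_integral do rewrite muleC.
rewrite integralZl//; last first.
  apply: ge0_integrable => //; first exact/measurable_EFinP.
  rewrite integral_indic// setIT.
  exact: le_lt_trans (estimator_le1 _ _ mA) (ltry _).
by rewrite integral_indic// setIT.
Qed.

(** Multiplying by dP'/dP at observation [i] replaces [mu] by [mu'], and the -1
    of the score subtracts the expectation under [mu]. *)
Lemma expect_score_attack M mu mu' (i : 'I_n) A : measurable A ->
  (forall j, j != i :> nat -> mu' j = mu j) ->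
  mu' i `<< mu i ->
  expect M (product_law n mu)
    (fun Z u => attack A (relative_score (mu' i) (mu i)) (tnth Z i) u) =
  output_law M (product_law n mu') A - output_law M (product_law n mu) A.
Proof.
move=> mA mumu' mu'mu.
(* [relative_score] is built on a derivative of charges, whose sign is known only
   almost everywhere; [g] is a version of it that is nonnegative everywhere. *)
pose g := Radon_Nikodym_SigmaFinite.f (mu' i) (mu i).
have g0 x : 0 <= g x by exact: Radon_Nikodym_SigmaFinite.f_ge0.
have gfin x : g x \is a fin_num by exact: Radon_Nikodym_SigmaFinite.f_fin_num.
have mg : measurable_fun setT g.
  by apply: measurable_int; exact: Radon_Nikodym_SigmaFinite.f_integrable.
have mT : measurable_fun setT (relative_score (mu' i) (mu i)).
  exact: emeasurable_funB.
have Tfin x : relative_score (mu' i) (mu i) x \is a fin_num.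
  by rewrite /relative_score fin_numB Radon_Nikodym_fin_num.
have mtnth : measurable_fun [set: n.-tuple obs] (@tnth n obs ^~ i).
  exact: measurable_tnth.
have mq : measurable_fun [set: n.-tuple obs] (fun Z => M Z A).
  exact: measurable_kernel.
have mgq : measurable_fun [set: n.-tuple obs] (fun Z => g (tnth Z i) * M Z A).
  by apply: emeasurable_funM => //; exact: measurableT_comp mg mtnth.
have gqE : \int[product_law n mu]_Z (g (tnth Z i) * M Z A) =
    output_law M (product_law n mu') A.
  rewrite /output_law (product_law_density mumu' mg g0)//.
  move=> phi mphi phi0.
  under [RHS]eq_integral do rewrite muleC.
  by rewrite Radon_Nikodym_SigmaFinite.change_of_variables.
(* Both versions agree outside a set of samples that is null because the
   marginal of [product_law n mu] at [i] is [mu i]. *)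
transitivity (\int[product_law n mu]_Z ((g (tnth Z i) - 1) * M Z A)).
  rewrite /expect; under eq_integral do rewrite integral_attack//.
  apply: ae_eq_integral => //.
  - apply: emeasurable_funM => //; exact: measurableT_comp mT mtnth.
  - apply: emeasurable_funM => //; apply: emeasurable_funB => //.
    exact: measurableT_comp mg mtnth.
  have [B [mB B0 gB]] := ae_eq_Radon_Nikodym_SigmaFinite mu'mu measurableT.
  exists ((@tnth n obs ^~ i) @^-1` B); split.
  - by rewrite -[X in measurable X]setTI; exact: mtnth.
  - exact: etrans (product_law_tnth mu i mB) B0.
  - move=> Z /= nZ; apply: gB => /= h; apply: nZ => _.
    by rewrite /relative_score -h.
under eq_integral => Z _.
  rewrite muleBl ?mul1e; [over|exact: estimator_fin_num|].
  by rewrite fin_num_adde_defl.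
rewrite integralB//.
- by rewrite gqE.
- apply: ge0_integrable => //; first by move=> Z; rewrite mule_ge0.
  by rewrite gqE (le_lt_trans (output_law_le1 _ _ mA))// ltry.
- apply: ge0_integrable => //.
  exact: le_lt_trans (output_law_le1 _ _ mA) (ltry _).
Qed.

End score_attack.

(** * Telescoping over observations and along paths *)

Section telescoping.
Context (R : realType) (d n : nat).
Local Notation vec := 'rV[R]_d.
Local Notation obs := (R * vec)%type.
Local Open Scope ereal_scope.
Implicit Types (M : estimator R d n) (A : set vec) (P : probability obs R).

Lemma interpolating_law0 P' P : interpolating_law n P' P 0 = iid n P.
Proof. exact: eq_product_law. Qed.

Lemma interpolating_lawn P' P : interpolating_law n P' P n = iid n P'.
Proof. by apply: eq_product_law => j jn; rewrite jn. Qed.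

Lemma sum_expect_score_attack M A P' P : measurable A -> P' `<< P ->
  \sum_(i < n) expect M (interpolating_law n P' P i)
    (fun Z u => attack A (relative_score P' P) (tnth Z i) u) =
  output_law M (iid n P') A - output_law M (iid n P) A.
Proof.
move=> mA P'P.
pose f i := output_law M (interpolating_law n P' P i) A.
rewrite (eq_bigr (fun i : 'I_n => f i.+1 - f i)); last first.
  move=> i _.
  (* The interpolating laws at [i] and [i.+1] differ in coordinate [i] alone. *)
  have := @expect_score_attack _ _ _ M (fun j => if (j < i)%N then P' else P)
    (fun j => if (j < i.+1)%N then P' else P) i A mA.
  rewrite /= ltnn ltnSn; apply => // j ji.
  by rewrite ltnS leq_eqVlt (negbTE ji).
rewrite -(big_mkord xpredT (fun i => f i.+1 - f i)) telescope_sume//.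
  by rewrite /f interpolating_law0 interpolating_lawn.
by move=> i _; exact: output_law_fin_num.
Qed.

Lemma sum_path_output_law M A (P : nat -> probability obs R) L : measurable A ->
  \sum_(1 <= l < L.+1) (output_law M (iid n (P l)) A
                        - output_law M (iid n (P l.-1)) A) =
  output_law M (iid n (P L)) A - output_law M (iid n (P 0%N)) A.
Proof.
move=> mA; rewrite big_add1/=.
rewrite (telescope_sume (f := fun l => output_law M (iid n (P l)) A))//.
by move=> i _; exact: output_law_fin_num.
Qed.

Lemma path_vertex0 (B : {set 'I_d}) q : path_vertex B q 0 = B.
Proof. by []. Qed.

Lemma path_vertex_last (B : {set 'I_d}) q : path_vertex B q (size q) = last B q.
Proof. by rewrite /path_vertex -[size q]/(size (B :: q)).-1 nth_last. Qed.

End telescoping.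

(** * Decoding cells *)

Section cells.
Context (R : realType) (d N : nat) (beta : 'I_N -> 'rV[R]_d).

Lemma vhatP u v : vhat beta u = Some v <->
  nearest beta u v /\ forall k, nearest beta u k -> (v <= k)%N.
Proof.
rewrite /vhat; case: pickP => [j /andP[nj /forallP jmin]|H]; last first.
  split => // -[nv vmin]; have := H v; rewrite nv /= => /negP[].
  by apply/forallP => k; apply/implyP; exact: vmin.
split=> [[<-]|[nv vmin]].
  by split=> // k nk; have := jmin k; rewrite nk.
congr Some; apply/val_inj/eqP; rewrite eqn_leq vmin// andbT.
by have := jmin v; rewrite nv.
Qed.

Lemma measurable_l2norm (b : 'rV[R]_d) :
  measurable_fun [set: 'rV[R]_d] (fun u => l2norm (u - b)).
Proof.
have msqrt : measurable_fun [set: R] (@Num.sqrt R).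
  by apply: continuous_measurable_fun; exact: sqrt_continuous.
have msum : measurable_fun [set: 'rV[R]_d]
    (fun u => \sum_(j < d) (u - b) ord0 j ^+ 2).
  apply: measurable_sum => j; apply: measurable_funX.
  under eq_fun do rewrite !mxE.
  exact: measurable_funB (measurable_rV_coord j) (measurable_cst _).
exact: measurableT_comp msqrt msum.
Qed.

Lemma measurable_cell v : measurable (cell beta v).
Proof.
have mnear k : measurable [set u | nearest beta u k].
  rewrite (_ : mkset _ =
      \bigcap_(j in [set: 'I_N])
        [set u | l2norm (u - beta k) <= l2norm (u - beta j)]); last first.
    apply/seteqP; split=> u /=; first by move=> /forallP + j _; exact.
    by move=> h; apply/forallP => j; exact: h.
  apply: fin_bigcap_measurable => // j _.
  rewrite -[X in measurable X]setTI.
  exact: (measurable_fun_ler (measurable_l2norm _) (measurable_l2norm _)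
    measurableT (Y := [set true])).
rewrite (_ : cell beta v = [set u | nearest beta u v] `&`
    \bigcap_(k in [set k : 'I_N | (k < v)%N]) ~` [set u | nearest beta u k]).
  apply: measurableI; first exact: mnear.
  by apply: fin_bigcap_measurable => // k _; apply: measurableC; exact: mnear.
apply/seteqP; split=> u /=.
  move=> /vhatP[nv vmin]; split=> // k /= kv nk.
  by have := vmin _ nk; rewrite leqNgt kv.
move=> [nv h]; apply/vhatP; split=> // k nk; rewrite leqNgt; apply/negP => kv.
exact: h kv nk.
Qed.

Lemma trivIset_cell : trivIset [set: 'I_N] (cell beta).
Proof. by move=> i j _ _ [u [ui uj]]; case: (etrans (esym ui) uj). Qed.

Lemma bigsetU_cell : (0 < N)%N -> \big[setU/set0]_(v < N) cell beta v = setT.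
Proof.
move=> N0; apply/seteqP; split=> // u _.
by have [j uj] := vhat_total beta u N0; rewrite (bigD1 j)//=; left.
Qed.

End cells.

(** * The probability of a decoding error *)

Section decoding_error.
Context (R : realType) (d n N : nat) (beta : 'I_N -> 'rV[R]_d).
Local Notation vec := 'rV[R]_d.
Local Notation obs := (R * vec)%type.
Implicit Types (M : estimator R d n) (P : probability (n.-tuple obs) R).

Lemma sqr_l2norm (u : vec) : l2norm u ^+ 2 = \sum_(j < d) u ord0 j ^+ 2.
Proof. by rewrite sqr_sqrtr// sumr_ge0// => j _; rewrite sqr_ge0. Qed.

(** The parallelogram identity, with the square of the norm of 2u - x - y dropped;
    for codewords 2r apart it is as sharp as the triangle inequality. *)
Lemma sqr_l2normB_le (u x y : vec) :
  l2norm (x - y) ^+ 2 <= 2 * (l2norm (u - x) ^+ 2 + l2norm (u - y) ^+ 2).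
Proof.
rewrite !sqr_l2norm -big_split/= mulr_sumr; apply: ler_sum => j _.
rewrite !mxE -subr_ge0.
rewrite (_ : _ - _ = (2 * u ord0 j - x ord0 j - y ord0 j) ^+ 2); last by ring.
exact: sqr_ge0.
Qed.

(** If [u] decodes to [j], then it is at least as close to [beta j] as to
    [beta v], so 4 r^2 <= ||beta v - beta j||^2 <= 4 ||u - beta v||^2. *)
Lemma sqr_l2norm_notin_cell (r : R) (u : vec) v : 0 < r ->
  (forall k, v != k -> 2 * r <= l2norm (beta v - beta k)) ->
  ~ cell beta v u -> r ^+ 2 <= l2norm (u - beta v) ^+ 2.
Proof.
move=> r0 sep uv.
have [j uj] := vhat_total beta u (leq_ltn_trans (leq0n v) (ltn_ord v)).
have vj : v != j by apply/eqP => vj; apply: uv; rewrite /cell/= uj vj.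
have [/forallP/(_ v) uj_le _] := (vhatP beta u j).1 uj.
have h1 := sqr_l2normB_le u (beta v) (beta j).
have h2 : (2 * r) ^+ 2 <= l2norm (beta v - beta j) ^+ 2.
  by rewrite ler_pXn2r ?nnegrE ?sqrtr_ge0 ?sep// mulr_ge0// ltW.
have h3 : l2norm (u - beta j) ^+ 2 <= l2norm (u - beta v) ^+ 2.
  by rewrite ler_pXn2r ?nnegrE ?sqrtr_ge0.
move: h1 h2 h3; rewrite exprMn; set a := r ^+ 2; set b := _ ^+ 2; lra.
Qed.

Local Open Scope ereal_scope.

Lemma output_lawC M P (A : set vec) : measurable A ->
  output_law M P A + output_law M P (~` A) = 1.
Proof.
move=> mA; have mAC := measurableC mA.
rewrite /output_law -ge0_integralD//=; [|exact: measurable_kernel..].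
rewrite -[RHS](integral_prob_cst P); apply: eq_integral => Z _.
by rewrite -measureU// ?setICr// setUCr; exact: prob_kernel.
Qed.

Lemma sum_output_law_cell M P : (0 < N)%N ->
  \sum_(v < N) output_law M P (cell beta v) = 1.
Proof.
move=> N0; rewrite /output_law -ge0_integral_sum//; last first.
  by move=> v; apply: measurable_kernel; exact: measurable_cell.
rewrite -[RHS](integral_prob_cst P); apply: eq_integral => Z _.
rewrite -measure_bigsetU_ord.
- by rewrite bigsetU_cell//; exact: prob_kernel.
- by move=> v; exact: measurable_cell.
- exact: trivIset_cell.
Qed.

(** Markov's inequality for the squared error, applied to the law of the output
    given the data and then averaged over the data. *)
Lemma output_law_notin_cell_le M P v (r : R) : (0 < r)%R ->
  (forall k, v != k -> 2 * r <= l2norm (beta v - beta k))%R ->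
  (r ^+ 2)%:E * output_law M P (~` cell beta v) <=
  expect M P (fun _ u => (l2norm (u - beta v) ^+ 2)%:E).
Proof.
move=> r0 sep.
have mA := measurableC (measurable_cell beta v).
have ml : measurable_fun [set: vec] (fun u => (l2norm (u - beta v) ^+ 2)%:E).
  by apply/measurable_EFinP; apply: measurable_funX; exact: measurable_l2norm.
have mk : measurable_fun [set: n.-tuple obs] (fun Z => M Z (~` cell beta v)).
  exact: measurable_kernel.
rewrite /output_law -ge0_integralZl ?lee_fin ?sqr_ge0//.
apply: ge0_le_integral => //.
- by move=> Z _; rewrite mule_ge0// lee_fin sqr_ge0.
- exact: measurable_funeM.
- apply: measurable_fun_integral_kernel => //.
    by move=> U mU; exact: measurable_kernel.
  by move=> u; rewrite lee_fin sqr_ge0.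
move=> Z _; rewrite -(integral_attack M Z mA)//.
apply: ge0_le_integral => //.
- by move=> u _; rewrite mule_ge0// lee_fin sqr_ge0.
- apply: emeasurable_funM => //; exact/measurable_EFinP.
- move=> u _; rewrite indicE; case: (boolP (u \in ~` cell beta v)).
    rewrite inE mul1e lee_fin; exact: sqr_l2norm_notin_cell.
  by rewrite mul0e lee_fin sqr_ge0.
Qed.

End decoding_error.

(** * Averaging over ordered pairs of codewords *)

Section identity.
Context (R : realType) (d n N : nat) (G : glm R d) (M : estimator R d n).
Context (S : 'I_N -> {set 'I_d}) (a : R) (p : 'I_N -> 'I_N -> seq {set 'I_d}).
Let beta v : 'rV[R]_d := a *: indvec R (S v).
Let Pn v := iid n (glm_law G (beta v)).

Lemma averaged_attackE : (forall v k, last (S k) (p v k) = S v) ->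
  averaged_attack G M a S p = (((N%:R ^+ 2)^-1)%:E *
    \sum_(v < N) \sum_(k < N)
      (output_law M (Pn v) (cell beta v) - output_law M (Pn k) (cell beta v)))%E.
Proof.
move=> plast; congr (_ * _)%E; apply: eq_bigr => v _; apply: eq_bigr => k _.
have mA := measurable_cell beta v.
under eq_bigr => l _.
  rewrite sum_expect_score_attack//; last exact: glm_law_abs_cont.
  over.
rewrite (sum_path_output_law M
  (fun l => glm_law G (a *: indvec R (path_vertex (S k) (p v k) l))))//.
by rewrite path_vertex_last plast path_vertex0.
Qed.

End identity.

(** Here [Q k v] stands for the probability of decoding to [v] when the truth is
    [k]. *)
Section decoding_matrix.
Context (R : realType) (N : nat) (Q : 'I_N -> 'I_N -> R).
Context (N0 : (0 < N)%N) (Q1 : forall k, \sum_(v < N) Q k v = 1).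

Lemma avg_decoding_gap :
  (N%:R ^+ 2)^-1 * \sum_(v < N) \sum_(k < N) (Q v v - Q k v) =
  N%:R^-1 * \sum_(v < N) Q v v - N%:R^-1.
Proof.
have N_neq0 : N%:R != 0 :> R by rewrite pnatr_eq0 -lt0n.
under eq_bigr do rewrite big_split/= sumr_const card_ord sumrN.
rewrite big_split/= sumrMnl sumrN exchange_big/=.
under [X in _ - X]eq_bigr do rewrite Q1.
rewrite sumr_const card_ord -mulr_natr.
by field.
Qed.

Lemma avg_decoding_gap_ge (t : R) : (forall v, 1 - t <= Q v v) ->
  1 - t - N%:R^-1 <=
  (N%:R ^+ 2)^-1 * \sum_(v < N) \sum_(k < N) (Q v v - Q k v).
Proof.
have N_gt0 : 0 < N%:R :> R by rewrite ltr0n.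
move=> Qt; rewrite avg_decoding_gap lerD2r ler_pdivlMl//.
rewrite -[leLHS]mulrC mulr_natr -[in leLHS](card_ord N) -sumr_const.
by apply: ler_sum => v _; exact: Qt.
Qed.

Lemma avg_decoding_gap_le (e t : R) : (forall v k, Q v v <= e * Q k v + t) ->
  (N%:R ^+ 2)^-1 * \sum_(v < N) \sum_(k < N) (Q v v - Q k v) <=
  (e - 1) / N%:R + t.
Proof.
have N_gt0 : 0 < N%:R :> R by rewrite ltr0n.
move=> Qet; rewrite ler_pdivrMl ?exprn_gt0//.
apply: (@le_trans _ _ (\sum_(v < N) \sum_(k < N) ((e - 1) * Q k v + t))).
  apply: ler_sum => v _; apply: ler_sum => k _.
  by have := Qet v k; lra.
rewrite exchange_big/=.
under eq_bigr do rewrite big_split/= -mulr_sumr Q1 sumr_const card_ord.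
rewrite sumr_const card_ord -(mulr_natr t) -(mulr_natr (_ + _)).
rewrite le_eqVlt; apply/orP; left; apply/eqP.
by field; rewrite gt_eqF.
Qed.

End decoding_matrix.

(** * Group privacy *)

Section group_privacy.
Context (R : realType) (d n : nat).
Local Notation vec := 'rV[R]_d.
Local Notation obs := (R * vec)%type.
Implicit Types (Z : n.-tuple obs).

Lemma hammingE Z Z' : hamming Z Z' = (\sum_(i < n) (tnth Z i != tnth Z' i))%N.
Proof.
rewrite /hamming -sum1_card big_mkcond; apply: eq_bigr => i _.
case: ifPn => [|nZ]; first by rewrite inE /= => ->.
by case: eqP => // /eqP ZZ'; move: nZ; rewrite notin_setE /= ZZ'.
Qed.

Lemma hamming_eq0 Z Z' : hamming Z Z' = 0%N -> Z = Z'.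
Proof.
rewrite hammingE => /eqP; rewrite sum_nat_eq0 => /forallP h.
by apply: eq_from_tnth => i; have := h i; rewrite implyTb eqb0 negbK => /eqP.
Qed.

Definition replace_record Z Z' (i : 'I_n) : n.-tuple obs :=
  [tuple if j == i then tnth Z' j else tnth Z j | j < n].

Lemma hamming_replace_record Z Z' i : tnth Z i != tnth Z' i ->
  hamming Z (replace_record Z Z' i) = 1%N.
Proof.
move=> ZZ'; rewrite hammingE (bigD1 i)//= tnth_mktuple eqxx ZZ' big1// => j ji.
by rewrite tnth_mktuple (negbTE ji) eqxx.
Qed.

Lemma hamming_replace_recordS Z Z' i : tnth Z i != tnth Z' i ->
  hamming Z Z' = (hamming (replace_record Z Z' i) Z').+1.
Proof.
move=> ZZ'; rewrite !hammingE (bigD1 i)//= [in RHS](bigD1 i)//=.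
rewrite tnth_mktuple !eqxx ZZ' add0n add1n; congr S.
by apply: eq_bigr => j ji; rewrite tnth_mktuple (negbTE ji).
Qed.

(** Replacing a differing record of [Z] by that of [Z'] costs one application of
    privacy and lowers the distance to [Z'] by one. The additive errors obey
    delta_(m+1) = delta + e^eps delta_m, which is the geometric sum. *)
Lemma group_privacy (M : estimator R d n) (eps delta : R) (A : set vec) m Z Z' :
  0 <= eps -> 0 <= delta -> diff_private eps delta M -> measurable A ->
  (hamming Z Z' <= m)%N ->
  fine (M Z A) <= expR (m%:R * eps) * fine (M Z' A)
                  + delta * \sum_(j < m) expR (j%:R * eps).
Proof.
move=> eps0 delta0 dpM mA; elim: m Z => [|m IH] Z.
  rewrite leqn0 => /eqP/hamming_eq0 ->.
  by rewrite mul0r expR0 mul1r big_ord0 mulr0 addr0.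
have M0 W : 0 <= fine (M W A) by exact: fine_ge0.
case: (posnP (hamming Z Z')) => [/hamming_eq0 <- _|].
  rewrite -[leLHS]mul1r -[leLHS]addr0 lerD//.
    by rewrite ler_wpM2r// -expR0 ler_expR mulr_ge0.
  by rewrite mulr_ge0// sumr_ge0// => j _; exact: expR_ge0.
rewrite [in X in X -> _]hammingE lt0n sum_nat_eq0 => /forallPn[i].
rewrite implyTb eqb0 negbK => ZZ'.
rewrite (hamming_replace_recordS ZZ') ltnS => /IH {}IH.
have := dpM _ _ (hamming_replace_record ZZ') _ mA.
rewrite -(fineK (estimator_fin_num M Z mA)).
rewrite -(fineK (estimator_fin_num M (replace_record Z Z' i) mA)).
rewrite -EFinM -EFinD lee_fin => /le_trans; apply.
have -> : expR (m.+1%:R * eps) = expR eps * expR (m%:R * eps).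
  by rewrite -expRD -natr1; congr expR; ring.
have -> : \sum_(j < m.+1) expR (j%:R * eps) =
    1 + expR eps * \sum_(j < m) expR (j%:R * eps).
  rewrite big_ord_recl mul0r expR0 mulr_sumr; congr (1 + _).
  apply: eq_bigr => j _; rewrite -expRD lift0 -natr1; congr expR; ring.
have := ler_wpM2l (expR_ge0 eps) IH; lra.
Qed.

End group_privacy.

(** * Comparing output laws through a coupling *)

Section coupling.
Context (R : realType) (d n : nat).
Local Notation vec := 'rV[R]_d.
Local Notation obs := (R * vec)%type.
Local Notation dataset := (n.-tuple obs).
Implicit Types (P Q : probability dataset R)
  (gamma : probability (dataset * dataset)%type R).

(** Two records are equal when their coordinates are, and equality of two
    measurable real functions is a measurable event. *)
Lemma measurable_eq_record (i : 'I_n) :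
  measurable [set w : dataset * dataset | tnth w.1 i = tnth w.2 i].
Proof.
have mfst : measurable_fun [set: dataset * dataset] (fun w => tnth w.1 i).
  exact: measurableT_comp (@measurable_tnth _ obs _ i) measurable_fst.
have msnd : measurable_fun [set: dataset * dataset] (fun w => tnth w.2 i).
  exact: measurableT_comp (@measurable_tnth _ obs _ i) measurable_snd.
have meq (f : obs -> R) : measurable_fun setT f ->
    measurable [set w : dataset * dataset | f (tnth w.1 i) = f (tnth w.2 i)].
  move=> mf.
  rewrite [X in measurable X](_ : _ =
      (fun w : dataset * dataset => f (tnth w.1 i) == f (tnth w.2 i))
        @^-1` [set true]).
    rewrite -[X in measurable X]setTI.
    exact: (measurable_fun_eqr (measurableT_comp mf mfst)
      (measurableT_comp mf msnd) measurableT (Y := [set true])).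
  by apply/seteqP; split => w /= /eqP.
have <- : [set w : dataset * dataset | (tnth w.1 i).1 = (tnth w.2 i).1] `&`
   \bigcap_(j in [set: 'I_d]) [set w : dataset * dataset |
     (tnth w.1 i).2 ord0 j = (tnth w.2 i).2 ord0 j] =
   [set w : dataset * dataset | tnth w.1 i = tnth w.2 i].
  apply/seteqP; split => w /= => [[w1 w2]|ww]; last first.
    by split => [|j _] /=; rewrite ww.
  rewrite (surjective_pairing (tnth w.1 i)) (surjective_pairing (tnth w.2 i)) w1.
  by congr pair; apply/rowP => j; exact: (w2 j I).
apply: measurableI; first by apply: (meq fst); exact: measurable_fst.
apply: fin_bigcap_measurable => // j _.
apply: (meq (fun z => z.2 ord0 j)).
exact: (measurableT_comp (measurable_rV_coord j) measurable_snd).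
Qed.

Lemma measurable_hamming :
  measurable_fun [set: dataset * dataset] (fun w => (hamming w.1 w.2)%:R : R).
Proof.
rewrite (_ : (fun _ => _) = fun w : dataset * dataset =>
    \sum_(i < n)
      \1_(~` [set w : dataset * dataset | tnth w.1 i = tnth w.2 i]) w : R).
  apply: measurable_sum => i; apply: measurable_indic.
  by apply: measurableC; exact: measurable_eq_record.
apply/funext => w; rewrite hammingE natr_sum; apply: eq_bigr => i _.
rewrite indicE; congr (nat_of_bool _)%:R.
by apply/idP/idP; rewrite inE /= => /eqP.
Qed.

Lemma measurable_hamming_gt m :
  measurable [set w : dataset * dataset | (m < hamming w.1 w.2)%N].
Proof.
rewrite [X in measurable X](_ : _ =
    ~` [set w | (hamming w.1 w.2)%:R <= m%:R :> R]).
  apply: measurableC; rewrite -[X in measurable X]setTI.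
  exact: (measurable_fun_ler measurable_hamming (measurable_cst _)
    measurableT (Y := [set true])).
apply/seteqP; split => w /=; rewrite ler_nat ltnNge; first by move/negP.
by move=> ?; apply/negP.
Qed.

Local Open Scope ereal_scope.

Lemma integral_coupling P Q gamma (f : dataset -> \bar R) :
  coupling P Q gamma ->
  measurable_fun [set: dataset] f -> (forall Z, 0 <= f Z) ->
  \int[P]_Z f Z = \int[gamma]_w f w.1 /\ \int[Q]_Z f Z = \int[gamma]_w f w.2.
Proof.
move=> cpl mf f0; split.
- transitivity (\int[pushforward gamma fst]_Z f Z).
    apply: eq_measure_integral => A mA _; apply: etrans (esym (cpl A mA).1) _.
    by congr (gamma _); apply/seteqP; split => -[x y] //= [].
  by rewrite ge0_integral_pushforward.
- transitivity (\int[pushforward gamma snd]_Z f Z).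
    apply: eq_measure_integral => A mA _; apply: etrans (esym (cpl A mA).2) _.
    by congr (gamma _); apply/seteqP; split => -[x y] //= [].
  by rewrite ge0_integral_pushforward.
Qed.

(** The Hamming distance is an integer, so exceeding [m] means reaching m + 1,
    and m + 1 > 20 D by definition of the floor. *)
Lemma hamming_tail gamma (D : R) :
  expected_hamming gamma <= D%:E ->
  gamma [set w | (Num.truncn (20 * D) < hamming w.1 w.2)%N] <= (20^-1)%:E.
Proof.
set m := Num.truncn (20 * D); set B := [set w | _] => hD.
have mB : measurable B by exact: measurable_hamming_gt.
have mI : measurable_fun [set: dataset * dataset] (fun w => (\1_B w)%:E : \bar R).
  exact/measurable_EFinP.
have tail : (m.+1%:R)%:E * gamma B <= D%:E.
  rewrite -(setIT B) -integral_indic// -ge0_integralZl ?lee_fin//.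
  apply: le_trans hD; apply: ge0_le_integral => //.
  - exact: measurable_funeM.
  - by apply/measurable_EFinP; exact: measurable_hamming.
  - move=> w _; rewrite indicE; case: (boolP (w \in B)).
      by rewrite inE mule1 lee_fin ler_nat.
    by rewrite mule0 lee_fin.
have := truncnS_gt (20 * D)%R; rewrite -/m => Dm.
have gfin : gamma B \is a fin_num by exact: fin_num_measure.
move: tail; rewrite -(fineK gfin) -EFinM !lee_fin => tail.
have m0 : (0 < m.+1%:R :> R)%R by rewrite ltr0n.
rewrite -(ler_pM2l m0); lra.
Qed.

(** Split the coupled pair according to whether its Hamming distance exceeds [m]:
    if not, group privacy applies; if so, the probability of the output event is
    bounded by 1, on a set of mass at most 1/20. *)
Lemma diff_private_coupling (M : estimator R d n) (eps delta D : R) A P Q gamma :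
  (0 <= eps)%R -> (0 <= delta)%R -> diff_private eps delta M -> measurable A ->
  coupling P Q gamma -> expected_hamming gamma <= D%:E ->
  let m := Num.truncn (20 * D) in
  (fine (output_law M P A) <= expR (m%:R * eps) * fine (output_law M Q A)
    + (20^-1 + delta * \sum_(j < m) expR (j%:R * eps)))%R.
Proof.
move=> eps0 delta0 dpM mA cpl hD; set m := Num.truncn _; cbv zeta.
set e := expR _; set dm := (delta * _)%R.
have e0 : (0 <= e)%R by exact: expR_ge0.
have dm0 : (0 <= dm)%R.
  by rewrite mulr_ge0// sumr_ge0// => j _; exact: expR_ge0.
pose B := [set w : dataset * dataset | (m < hamming w.1 w.2)%N].
have mB : measurable B by exact: measurable_hamming_gt.
have mM : measurable_fun [set: dataset] (fun Z => M Z A).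
  exact: measurable_kernel.
have mM1 : measurable_fun [set: dataset * dataset] (fun w => M w.1 A).
  exact: measurableT_comp mM measurable_fst.
have mM2 : measurable_fun [set: dataset * dataset] (fun w => M w.2 A).
  exact: measurableT_comp mM measurable_snd.
have [P_E _] := integral_coupling cpl mM (fun Z => measure_ge0 _ _).
have [_ Q_E] := integral_coupling cpl mM (fun Z => measure_ge0 _ _).
suff: output_law M P A <= e%:E * output_law M Q A + dm%:E + gamma B.
  have := hamming_tail hD; rewrite -/B.
  have gfin : gamma B \is a fin_num by exact: fin_num_measure.
  rewrite -(fineK gfin) -(fineK (output_law_fin_num M P mA)).
  rewrite -(fineK (output_law_fin_num M Q mA)) -EFinM -!EFinD !lee_fin/=; lra.
rewrite /output_law P_E Q_E -ge0_integralZl//.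
rewrite -(integral_prob_cst gamma dm%:E) -(setIT B) -integral_indic//.
have mI : measurable_fun [set: dataset * dataset] (fun w => (\1_B w)%:E : \bar R).
  exact/measurable_EFinP.
have meM2 : measurable_fun [set: dataset * dataset] (fun w => e%:E * M w.2 A).
  exact: measurable_funeM.
rewrite -ge0_integralD//; last by move=> w _; rewrite mule_ge0.
rewrite -ge0_integralD//; last 2 first.
- by move=> w _; rewrite adde_ge0// mule_ge0.
- exact: emeasurable_funD.
apply: ge0_le_integral => //.
- by apply: emeasurable_funD => //; exact: emeasurable_funD.
move=> w _; rewrite indicE; case: (boolP (w \in B)) => [_|].
  apply: (le_trans (estimator_le1 M w.1 mA)).
  by rewrite leeDr// adde_ge0// mule_ge0.
rewrite notin_setE => /negP; rewrite -leqNgt => wm; rewrite adde0.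
rewrite -(fineK (estimator_fin_num M w.1 mA)).
rewrite -(fineK (estimator_fin_num M w.2 mA)) -EFinM -EFinD lee_fin.
exact: group_privacy.
Qed.

End coupling.

(** * Completeness and soundness of the attack *)

Section attack_bounds.
Context (R : realType) (d n N : nat) (G : glm R d) (M : estimator R d n).
Context (S : 'I_N -> {set 'I_d}) (a : R) (p : 'I_N -> 'I_N -> seq {set 'I_d}).
Context (N0 : (0 < N)%N) (plast : forall v k, last (S k) (p v k) = S v).
Let beta v : 'rV[R]_d := a *: indvec R (S v).
Let Pn v := iid n (glm_law G (beta v)).
Let Q k v : R := fine (output_law M (Pn k) (cell beta v)).
Let Abar := averaged_attack G M a S p.
Let Risk := max_risk G M beta.

Let output_lawE k v : output_law M (Pn k) (cell beta v) = (Q k v)%:E.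
Proof. by rewrite fineK// output_law_fin_num//; exact: measurable_cell. Qed.

Let sum_Q k : \sum_(v < N) Q k v = 1.
Proof.
apply: EFin_inj; rewrite -sumEFin -(sum_output_law_cell beta M (Pn k) N0).
by apply: eq_bigr => v _; rewrite output_lawE.
Qed.

Let AbarE :
  Abar = ((N%:R ^+ 2)^-1 * \sum_(v < N) \sum_(k < N) (Q v v - Q k v))%:E.
Proof.
rewrite /Abar averaged_attackE// EFinM -sumEFin; congr (_ * _)%E.
apply: eq_bigr => v _; rewrite -sumEFin; apply: eq_bigr => k _.
by rewrite !output_lawE.
Qed.

Lemma max_risk_ge r v : 0 < r ->
  (forall k, v != k -> 2 * r <= l2norm (beta v - beta k)) ->
  ((r ^+ 2 * (1 - Q v v))%:E <= Risk)%E.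
Proof.
move=> r0 sep; apply: le_trans; last exact: le_bigmax v.
have mA := measurable_cell beta v.
apply: le_trans (output_law_notin_cell_le M (Pn v) r0 sep).
rewrite -(fineK (output_law_fin_num M (Pn v) (measurableC mA))) -EFinM lee_fin.
rewrite ler_wpM2l ?sqr_ge0//.
have := output_lawC M (Pn v) mA; rewrite output_lawE.
rewrite -(fineK (output_law_fin_num M (Pn v) (measurableC mA))) -EFinD.
by move=> [h]; lra.
Qed.

Lemma max_risk_ge0 r : 0 < r ->
  (forall v k, v != k -> 2 * r <= l2norm (beta v - beta k)) -> (0 <= Risk)%E.
Proof.
move=> r0 sep; apply: le_trans (max_risk_ge r0 (sep (Ordinal N0))).
rewrite lee_fin mulr_ge0 ?sqr_ge0// subr_ge0 -lee_fin -output_lawE.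
by apply: output_law_le1; exact: measurable_cell.
Qed.

Lemma averaged_attack_complete r : 0 < r ->
  (forall v k, v != k -> 2 * r <= l2norm (beta v - beta k)) ->
  (1 - Risk * ((r ^+ 2)^-1)%:E - (N%:R^-1)%:E <= Abar)%E.
Proof.
move=> r0 sep; have r20 : 0 < r ^+ 2 by rewrite exprn_gt0.
have := max_risk_ge0 r0 sep; rewrite AbarE.
case RiskE : Risk => [rho| |]// rho0.
- rewrite -EFinM -!EFinB lee_fin; apply: avg_decoding_gap_ge => // v.
  have := max_risk_ge r0 (sep v); rewrite RiskE lee_fin => h.
  by rewrite lerBlDr -lerBlDl ler_pdivlMr// mulrC.
(* For an infinite risk the left-hand side is -oo. *)
- by rewrite gt0_mulye ?lte_fin ?invr_gt0// addeNy addNye leNye.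
Qed.

Lemma averaged_attack_sound D eps delta :
  (forall v k, exists2 gamma, coupling (Pn v) (Pn k) gamma &
     (expected_hamming gamma <= D%:E)%E) ->
  0 <= eps -> 0 <= delta -> diff_private eps delta M ->
  let m := Num.truncn (20 * D) in
  (Abar <= ((expR (m%:R * eps) - 1) / N%:R + 20^-1
            + delta * \sum_(j < m) expR (j%:R * eps))%:E)%E.
Proof.
move=> cpl eps0 delta0 dpM; cbv zeta; rewrite AbarE lee_fin -addrA.
apply: avg_decoding_gap_le => // v k; have [gamma cplvk hD] := cpl v k.
exact: diff_private_coupling dpM (measurable_cell beta v) cplvk hD.
Qed.

End attack_bounds.

(** * The universal constants *)

Section constants.
Context (R : realType).

(** Equivalent to (x / 2 - 1)^2 >= 0; it is used at the square root of N. *)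
Lemma sqrt_growth_le (x : R) : 0 < x -> (x - 1) / (x * x) <= 4^-1.
Proof.
move=> x0; rewrite ler_pdivrMr ?mulr_gt0// -subr_ge0.
rewrite (_ : _ - _ = (x / 2 - 1) ^+ 2); last by field.
exact: sqr_ge0.
Qed.

(** With t = eps D one has m eps <= 20 t <= (ln N) / 5, so e^(m eps) is at most
    the square root of N and the first term is at most 1/4. Bounding each of the
    m <= 20 D terms of the sum by e^(20 t), the last term is at most
    (1/5) t e^(-t), and t <= e^t. *)
Lemma soundness_bound_le (N : nat) (D eps delta : R) :
  (0 < N)%N -> 0 <= D -> 0 < eps -> 0 <= delta ->
  eps * D <= 100^-1 * ln N%:R ->
  delta <= 100^-1 * eps * expR (- (21 * eps * D)) ->
  let m := Num.truncn (20 * D) in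
  (expR (m%:R * eps) - 1) / N%:R + 20^-1
    + delta * \sum_(j < m) expR (j%:R * eps) <= 2^-1.
Proof.
move=> N0 D0 eps0 delta0 epsD deltaD; set m := Num.truncn _; cbv zeta.
have N_gt0 : 0 < N%:R :> R by rewrite ltr0n.
have eps_ge0 := ltW eps0.
set t := eps * D in epsD; have t0 : 0 <= t by rewrite mulr_ge0.
have mD : m%:R <= 20 * D by rewrite truncn_le mulr_ge0.
have meps : m%:R * eps <= 20 * t.
  by rewrite /t [eps * D]mulrC mulrA ler_wpM2r.
have h1 : (expR (m%:R * eps) - 1) / N%:R <= 4^-1.
  have NE : N%:R = expR (ln N%:R / 2) * expR (ln N%:R / 2) :> R.
    by rewrite -expRD -splitr lnK.
  apply: le_trans (sqrt_growth_le (expR_gt0 (ln N%:R / 2))).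
  rewrite -NE ler_wpM2r ?invr_ge0 ?ler0n// lerD2r ler_expR.
  have : 0 <= ln N%:R :> R by rewrite ln_ge0// ler1n.
  by move: epsD meps; lra.
have h2 : \sum_(j < m) expR (j%:R * eps) <= 20 * D * expR (20 * t).
  apply: (@le_trans _ _ (\sum_(j < m) expR (20 * t))).
    apply: ler_sum => j _; rewrite ler_expR (le_trans _ meps)//.
    by rewrite ler_wpM2r// ler_nat ltnW.
  by rewrite sumr_const card_ord -(mulr_natl (expR _)) ler_wpM2r// expR_ge0.
have h3 : delta * \sum_(j < m) expR (j%:R * eps) <= 5^-1.
  apply: (@le_trans _ _ (100^-1 * eps * expR (- (21 * eps * D)) *
      (20 * D * expR (20 * t)))).
    by apply: ler_pM => //; rewrite sumr_ge0// => j _; exact: expR_ge0.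
  rewrite [leLHS](_ : _ =
      5^-1 * (t * (expR (- (21 * eps * D)) * expR (20 * t)))); last first.
    by rewrite /t; field.
  rewrite -expRD (_ : _ + _ = - t); last by rewrite /t; ring.
  rewrite -[leRHS]mulr1 ler_wpM2l// expRN ler_pdivrMr ?expR_gt0// mul1r.
  by have := expR_ge1Dx t; lra.
move: h1 h3; lra.
Qed.

End constants.

(** * The theorem *)

Theorem proposition5p1 (R : realType) :
  exists c C : R, 0 < c /\ 0 < C /\
  forall (d n s N : nat) (G : glm R d)
    (S : 'I_N -> {set 'I_d}) (a r : R)
    (p : 'I_N -> 'I_N -> seq {set 'I_d})
    (M : estimator R d n),
  let beta (v : 'I_N) : 'rV[R]_d := a *: indvec R (S v) in
  let Pn (v : 'I_N) := iid n (glm_law G (beta v)) in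
  let Risk := max_risk G M beta in
  let Abar := averaged_attack G M a S p in
  injective S ->
  (forall v, #|S v| = s) ->
  0 < a ->
  (forall v k, shortest_path s (S k) (S v) (p v k)) ->
  (4 <= N)%N ->
  0 < r ->
  (forall v k, v != k -> 2 * r <= l2norm (beta v - beta k)) ->
  [/\ Abar = (((N%:R ^+ 2)^-1)%:E *
        \sum_(v < N) \sum_(k < N)
          (output_law M (Pn v) (cell beta v)
           - output_law M (Pn k) (cell beta v)))%E,
      (1 - Risk * ((r ^+ 2)^-1)%:E - (N%:R^-1)%:E <= Abar)%E &
      forall (D eps delta : R),
        (forall v k, exists2 gamma, coupling (Pn v) (Pn k) gamma &
           (expected_hamming gamma <= D%:E)%E) ->
        0 <= eps -> 0 <= delta ->
        diff_private eps delta M ->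
        (* D is nonnegative here, so that m is the floor of 20 D *)
        let m := Num.truncn (20 * D) in
        let delta_m := delta * \sum_(j < m) expR (j%:R * eps) in
        (Abar <= ((expR (m%:R * eps) - 1) / N%:R + 20^-1 + delta_m)%:E)%E /\
        (0 < eps <= 1 -> eps * D <= c * ln N%:R ->
         delta <= c * eps * expR (- (C * eps * D)) ->
         ((c * r ^+ 2)%:E <= Risk)%E)].
Proof.
exists 100^-1, 21; split; first by rewrite invr_gt0.
split; first by [].
move=> d n s N G S a r p M beta Pn Risk Abar _ _ _ sp N4 r0 sep.
have N0 : (0 < N)%N by exact: leq_trans N4.
have plast v k : last (S k) (p v k) = S v by case: (sp v k).
have complete := averaged_attack_complete G M N0 plast r0 sep.
split => //; first exact: averaged_attackE.
move=> D eps delta cpl eps0 delta0 dpM m delta_m.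
have sound := averaged_attack_sound N0 plast cpl eps0 delta0 dpM.
split => // /andP[eps_gt0 _] epsD deltaD.
have D0 : 0 <= D.
  have [gamma _] := cpl (Ordinal N0) (Ordinal N0); rewrite -lee_fin.
  by apply: le_trans; apply: integral_ge0 => w _; rewrite lee_fin.
have half := soundness_bound_le N0 D0 eps_gt0 delta0 epsD deltaD.
have := le_trans complete sound; have := max_risk_ge0 G M N0 r0 sep.
(* It remains to compare 1 - R/r^2 - 1/N with 1/2. *)
rewrite -/beta -/Risk; case: Risk => [rho| |]// rho0; last by rewrite leey.
rewrite -EFinM -!EFinB !lee_fin => h.
have r20 : 0 < r ^+ 2 by rewrite exprn_gt0.
have N4' : N%:R^-1 <= 4^-1 :> R.
  by rewrite lef_pV2 ?posrE ?ltr0n// ler_nat.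
rewrite -ler_pdivlMr//; move: h half N4'; cbv zeta.
lra.
Qed.
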